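(* Let $\mathcal{H}$ and $\mathcal{G}$ be real Hilbert spaces, let $A:\mathcal{H}\to 2^{\mathcal{H}}$ be maximally $\rho$-monotone for some $\rho\in\mathbb{R}$, let $B:\mathcal{G}\to 2^{\mathcal{G}}$ be maximally monotone, let $L:\mathcal{H}\to\mathcal{G}$ be a bounded linear operator with adjoint $L^*$, and let $C:\mathcal{H}\to\mathcal{H}$ be $\zeta$-Lipschitz for some $\zeta\in\,]0,+\infty[$. Suppose that $A+C$ is maximally monotone and that there exists $(x,u)\in\mathcal{H}\times\mathcal{G}$ with $0\in(A+C)x+L^*u$ and $0\in B^{-1}u-Lx$. Let $(x_0,u_0)\in\mathcal{H}\times\mathcal{G}$, let $(\sigma,\tau)\in\,]0,+\infty[^2$ with $\tau\rho>-1$, and consider the recurrence, for every $n\in\mathbb{N}$, $$\begin{aligned} p_{n+1}&=Cx_n,\\ z_{n+1}&=J_{\tau A}\big(x_n-\tau(L^*u_n+p_{n+1})\big),\\ q_{n+1}&=\tau(Cz_{n+1}-p_{n+1}),\\ u_{n+1}&=J_{\sigma B^{-1}}\big(u_n+\sigma L(2z_{n+1}-x_n-q_{n+1})\big),\\ x_{n+1}&=z_{n+1}-q_{n+1}.\end{aligned}$$ Suppose that $$\tau\sigma\|L\|^2+\tau^2\zeta^2<1.$$ Then $(x_n,u_n)_{n\in\mathbb{N}}$ converges weakly to some $(x,u)\in\mathcal{H}\times\mathcal{G}$ such that $0\in(A+C)x+L^*u$ and $0\in B^{-1}u-Lx$.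
   Context: For a set-valued operator $A:\mathcal{H}\to 2^{\mathcal{H}}$, its graph is $\{(x,u): u\in Ax\}$ and its inverse is $A^{-1}u=\{x: u\in Ax\}$. For $\rho\in\mathbb{R}$, $A$ is $\rho$-monotone if $\langle x-y\mid u-v\rangle\ge\rho\|x-y\|^2$ for all $(x,u),(y,v)$ in its graph; it is maximally $\rho$-monotone if it is $\rho$-monotone and its graph is maximal for inclusion among graphs of $\rho$-monotone operators. (Maximally) monotone means (maximally) $0$-monotone. The resolvent is $J_A=(\mathrm{Id}+A)^{-1}$; it is single valued (and everywhere defined) when $A$ is maximally $\rho$-monotone with $\rho>-1$. An operator $T:\mathcal{H}\to\mathcal{H}$ is $\zeta$-Lipschitz if $\|Tx-Ty\|\le\zeta\|x-y\|$ for all $x,y\in\mathcal{H}$. *)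

(* Defs.v *)
From HB Require Import structures.
From mathcomp Require Import all_boot all_order all_algebra.
From mathcomp Require Import all_classical all_reals.
From mathcomp Require Import topology normedtype sequences.

Set Implicit Arguments.
Unset Strict Implicit.
Unset Printing Implicit Defensive.

Import Order.TTheory GRing.Theory Num.Theory.
Import numFieldNormedType.Exports.

Local Open Scope classical_set_scope.
Local Open Scope ring_scope.

HB.mixin Record Lmodule_isPreHilbert (R : realType) T & GRing.Lmodule R T := {
  inner : {dot T for (@idfun R)}
}.

#[short(type="preHilbertType")]
HB.structure Definition PreHilbert (R : realType) :=
  {T of GRing.Lmodule R T & Lmodule_isPreHilbert R T}.

HB.mixin Record CompleteNormedModule_isHilbert (R : realType) T
    & CompleteNormedModule R T & PreHilbert R T := {
  inner_norm : forall x : T, (inner : T -> T -> R) x x = `|x| ^+ 2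
}.

#[short(type="hilbertType")]
HB.structure Definition Hilbert (R : realType) :=
  {T of CompleteNormedModule R T & PreHilbert R T
      & CompleteNormedModule_isHilbert R T}.

Notation "''<' x | y >" := (inner x y)
  (at level 0, x at level 69, y at level 69, format "''<' x  |  y >") : ring_scope.

(* The scalar product of the Hilbert direct sum. The library norms V * W with
   the max norm, so V * W is a preHilbertType but not a hilbertType. *)
Section DirectSum.
Context {R : realType} (V W : preHilbertType R).

Definition prod_inner (p q : V * W) : R := '<p.1 | q.1> + '<p.2 | q.2>.

Lemma prod_inner_bilinear :
  bilinear_for (GRing.Scale.Law.clone _ _ *%R _)
    (GRing.Scale.Law.clone _ _ (@idfun R \; *%R) _) prod_inner.
Proof.
split=> [u a x y|u a x y]; rewrite /prod_inner /=.
  by rewrite !linearPl /= mulrDr addrACA.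
by rewrite !linearPr /= mulrDr addrACA.
Qed.

HB.instance Definition _ :=
  bilinear_isBilinear.Build R (V * W)%type (V * W)%type R _ _ prod_inner
    prod_inner_bilinear.

Lemma prod_inner_sym (p q : V * W) :
  prod_inner p q = (-1) ^+ false * idfun (prod_inner q p).
Proof.
rewrite /prod_inner (hermitian_subproof p.1) (hermitian_subproof p.2) /=.
by rewrite !expr0 !mul1r.
Qed.

HB.instance Definition _ :=
  isHermitianSesquilinear.Build R (V * W)%type false (@idfun R) prod_inner
    prod_inner_sym.

Lemma prod_inner_gt0 (p : V * W) : p != 0 -> 0 < prod_inner p p.
Proof.
have ge0 (U : preHilbertType R) (u : U) : 0 <= '<u | u>.
  have [->|u0] := eqVneq u 0; first by rewrite linear0l.
  exact/ltW/neq0_dnorm_gt0.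
case: p => v w; rewrite xpair_eqE negb_and /prod_inner /= => /orP[v0|w0].
  by rewrite ltr_pwDl// neq0_dnorm_gt0.
by rewrite ltr_wpDl// neq0_dnorm_gt0.
Qed.

HB.instance Definition _ :=
  isDotProduct.Build R (V * W)%type prod_inner prod_inner_gt0.

HB.instance Definition _ := Lmodule_isPreHilbert.Build R (V * W)%type prod_inner.

End DirectSum.

Definition weakly_cvg (R : realType) (V : preHilbertType R) (x_ : V^nat) (x : V) :=
  forall y : V, '<x_ n | y> @[n --> \oo] --> '<x | y>.

(* A point of [A x] is a u with [A x u]; the graph of A is thus the relation A
   itself. *)
Section SetValuedOperators.
Context {R : realType} {V : lmodType R}.
Implicit Types A B : V -> set V.

Definition graph A : set (V * V) := [set p | A p.1 p.2].

Definition opinv A : V -> set V := fun u => [set x | A x u].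

Definition opfun (f : V -> V) : V -> set V := fun x => [set f x].

Definition opadd A B : V -> set V :=
  fun x => [set u + v | u in A x & v in B x].

Definition opscale (a : R) A : V -> set V := fun x => [set a *: u | u in A x].

End SetValuedOperators.

Section Monotone.
Context {R : realType} {V : hilbertType R}.
Implicit Types (rho : R) (A : V -> set V).

Definition rho_monotone rho A :=
  forall x u y v, graph A (x, u) -> graph A (y, v) ->
    rho * `|x - y| ^+ 2 <= '<x - y | u - v>.

Definition maximally_rho_monotone rho A :=
  rho_monotone rho A /\
  forall A', rho_monotone rho A' -> graph A `<=` graph A' -> graph A' = graph A.

Definition maximally_monotone A := maximally_rho_monotone 0 A.

(* The value at y of (Id + A)^-1, as a point of V: meaningful where that set is
   a singleton. *)
Definition resolvent A (y : V) : V := xget 0 (opinv (opadd (opfun id) A) y).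

End Monotone.

Section BoundedLinear.
Context {R : realType} {V W : hilbertType R}.

Definition opnorm (L : {linear V -> W}) : R :=
  sup [set `|L x| | x in [set x | `|x| <= 1]].

(* The point y exists and is unique when L is bounded (Riesz). *)
Definition adjoint (L : {linear V -> W}) (u : W) : V :=
  xget 0 [set y | forall x, '<L x | u> = '<x | y> ].

End BoundedLinear.

(* 0 \in (A + C) x + L^* u and 0 \in B^-1 u - L x. *)
Definition kuhn_tucker (R : realType) (V W : hilbertType R) (A : V -> set V)
    (C : V -> V) (B : W -> set W) (L : {linear V -> W}) (x : V) (u : W) :=
  [set a + adjoint L u | a in opadd A (opfun C) x] 0 /\
  [set b - L x | b in opinv B u] 0.

(* Main.v *)
(* The iteration says that [(x_n - x_{n+1}) / tau - L^* u_n] lies in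
   [(A + C) z_{n+1}] and that
   [(u_n - u_{n+1}) / sigma + L (z_{n+1} + x_{n+1} - x_n)] lies in [B^-1 u_{n+1}].
   Monotonicity of [A + C] and [B^-1] against a Kuhn-Tucker point [(x, u)] makes
   [|x_n - x|^2 / tau + |u_n - u|^2 / sigma - 2 <L (x_n - x) | u_n - u>]
   nonincreasing, with a decrease that controls [|z_{n+1} - x_n|^2] and
   [|u_{n+1} - u_n|^2]: the step size condition is exactly the positivity of the
   quadratic form involved.  Weak cluster points are Kuhn-Tucker points by
   maximality, the bilinear terms in [L] cancelling up to a null sequence, and
   Opial's argument shows that the cluster point is unique.  That the resolvents are
   defined at all is Minty's theorem. *)
Require Import Defs.
From HB Require Import structures.
From mathcomp Require Import all_boot all_order all_algebra.
From mathcomp Require Import all_classical all_reals.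
From mathcomp Require Import topology normedtype sequences.
From mathcomp Require Import interval_inference ring lra.

Set Implicit Arguments.
Unset Strict Implicit.
Unset Printing Implicit Defensive.

Import Order.TTheory GRing.Theory Num.Theory.
Import numFieldNormedType.Exports.

Local Open Scope classical_set_scope.
Local Open Scope ring_scope.

(** * Inner products *)

Section InnerProduct.
Context {R : realType} {V : preHilbertType R}.
Implicit Types x y z : V.

Lemma innerC x y : '<x | y> = '<y | x>.
Proof. by rewrite (hermitian_subproof x) /= expr0 mul1r. Qed.

Lemma innerDl x y z : '<x + y | z> = '<x | z> + '<y | z>.
Proof. exact: linearDl. Qed.

Lemma innerDr x y z : '<x | y + z> = '<x | y> + '<x | z>.
Proof. exact: linearDr. Qed.

Lemma innerZl a x y : '<a *: x | y> = a * '<x | y>.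
Proof. exact: linearZl_LR. Qed.

Lemma innerZr a x y : '<x | a *: y> = a * '<x | y>.
Proof. exact: linearZr_LR. Qed.

Lemma innerNl x y : '<- x | y> = - '<x | y>.
Proof. exact: linearNl. Qed.

Lemma innerNr x y : '<x | - y> = - '<x | y>.
Proof. exact: linearNr. Qed.

Lemma inner0l y : '<0 | y> = 0.
Proof. exact: linear0l. Qed.

Lemma inner0r y : '<y | 0> = 0.
Proof. exact: linear0r. Qed.

Definition innerE :=
  (innerDl, innerDr, innerNl, innerNr, innerZl, innerZr, inner0l, inner0r).

End InnerProduct.

Section HilbertNorm.
Context {R : realType} {V : hilbertType R}.
Implicit Types x y : V.

Lemma sqr_normE x : `|x| ^+ 2 = '<x | x>.
Proof. by rewrite inner_norm. Qed.

Lemma inner_le_norm x y : '<x | y> <= `|x| * `|y|.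
Proof.
have [->|x0] := eqVneq x 0; first by rewrite inner0l normr0 mul0r.
have [->|y0] := eqVneq y 0; first by rewrite inner0r normr0 mulr0.
have : 0 <= `| `|y| *: x - `|x| *: y | ^+ 2 by exact: sqr_ge0.
rewrite sqr_normE !innerE (innerC y x) -!sqr_normE.
have -> : `|y| * (`|y| * `|x| ^+ 2) + - (`|y| * (`|x| * '<x | y>)) +
  (- (`|x| * (`|y| * '<x | y>)) - - (`|x| * (`|x| * `|y| ^+ 2))) =
  (2 * (`|x| * `|y|)) * (`|x| * `|y| - '<x | y>) by ring.
by rewrite pmulr_rge0 ?subr_ge0// mulr_gt0 ?mulr_gt0 ?normr_gt0.
Qed.

Lemma normr_inner_le x y : `|'<x | y>| <= `|x| * `|y|.
Proof.
by rewrite ler_norml inner_le_norm andbT lerNl -innerNl -(normrN x) inner_le_norm.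
Qed.

Lemma cvg_inner0 T (F : set_system T) (FF : Filter F) (f g : T -> V) M :
  (forall n, `|f n| <= M) -> `|g n| @[n --> F] --> 0 ->
  '<f n | g n> @[n --> F] --> 0.
Proof.
move=> fM g0; apply: norm_cvg0.
have h : M * `|g n| @[n --> F] --> 0.
  by rewrite -[X in _ --> X](mulr0 M); apply: cvgMl_tmp.
apply: (squeeze_cvgr _ (cvg_cst 0) h).
apply: nearW => n; rewrite normr_ge0 /= (le_trans (normr_inner_le _ _))//.
by rewrite ler_wpM2r.
Qed.

Lemma cvg_inner T (F : set_system T) (FF : Filter F) (f : T -> V) x y :
  f n @[n --> F] --> x -> '<f n | y> @[n --> F] --> '<x | y>.
Proof.
move=> fx; apply/subr_cvg0.
have fx0 : `|f n - x| @[n --> F] --> 0.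
  by rewrite -[X in _ --> X](normr0 V); apply: cvg_norm; apply/subr_cvg0.
have := @cvg_inner0 _ F FF (fun=> y) _ `|y| (fun=> lexx _) fx0.
by under eq_fun do rewrite innerC innerDl innerNl.
Qed.

(** The rate [d / n.+1] on squared distances is the form in which minimising sequences are
    controlled below. *)
Lemma cauchy_seq_cvg (x_ : V^nat) (d : R) :
  (forall n k, (n <= k)%N -> `|x_ n - x_ k| ^+ 2 <= d / n.+1%:R) ->
  cvg (x_ @ \oo).
Proof.
move=> hx; apply/cauchy_cvgP/cauchyP => e e0.
have d0 : 0 <= d by have := hx 0%N 0%N (leqnn _); rewrite subrr normr0 expr0n divr1.
have e2 : 0 < e ^+ 2 / (d + 1) by rewrite divr_gt0 ?exprn_gt0// ltr_wpDl.
have [N _ HN] := near_infty_natSinv_lt (PosNum e2).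
exists (x_ N); exists N => // k Nk; rewrite /= -ball_normE /=.
rewrite -(@ltr_pXn2r _ 2) ?nnegrE ?(ltW e0)//.
apply: le_lt_trans (hx _ _ Nk) _.
have := HN N (leqnn _); rewrite /= ltr_pdivlMr ?ltr_wpDl// => /(le_lt_trans _); apply.
by rewrite mulrC ler_wpM2l// lerDl.
Qed.

End HilbertNorm.

(** * Strongly convex minimisation, the Riesz and Minty theorems *)

Section Minimisation.
Context {R : realType} {U W : hilbertType R}.
(** [K] plays the role of the epigraph of a closed convex function on [U * W]. As a relation it
    allows the value +oo and also covers graphs of continuous linear forms. *)
Variable K : U -> W -> R -> Prop.
Hypothesis K_nonempty : exists x u t, K x u t.
Hypothesis K_convex : forall (s : R) x u t x' u' t', 0 <= s <= 1 ->
  K x u t -> K x' u' t' ->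
  K (x + s *: (x' - x)) (u + s *: (u' - u)) (t + s * (t' - t)).
Hypothesis K_closed : forall x_ u_ t_ x u (t : R),
  (forall n : nat, K (x_ n) (u_ n) (t_ n)) ->
  x_ n @[n --> \oo] --> x -> u_ n @[n --> \oo] --> u ->
  t_ n @[n --> \oo] --> t -> K x u t.

Let J (x : U) (u : W) (t : R) : R := t + (`|x| ^+ 2 + `|u| ^+ 2) / 2.

Hypothesis J_bounded : exists m, forall x u t, K x u t ->
  m <= t + (`|x| ^+ 2 + `|u| ^+ 2) / 2.

Let J_segment s x u t x' u' t' :
  J (x + s *: (x' - x)) (u + s *: (u' - u)) (t + s * (t' - t)) =
  J x u t + s * (t' - t + '<x | x' - x> + '<u | u' - u>) +
  s ^+ 2 / 2 * (`|x' - x| ^+ 2 + `|u' - u| ^+ 2).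
Proof.
rewrite /J !sqr_normE !innerE (innerC x' x) (innerC u' u); by field.
Qed.

(** The strongly convex [J] makes every minimising sequence Cauchy, and closedness puts the limit in
    [K]. The conclusion records the first-order optimality condition at that limit. *)
Lemma strongly_convex_minimiser : exists x u t, K x u t /\
  forall x' u' t', K x' u' t' -> t <= t' + '<x | x' - x> + '<u | u' - u>.
Proof.
pose S := [set r | exists x u t, K x u t /\ r = J x u t].
have [m Jm] := J_bounded.
have S_inf : has_inf S.
  split; first by have [x [u [t k]]] := K_nonempty; exists (J x u t), x, u, t.
  by exists m => _ [x [u [t [k ->]]]]; exact: Jm.
have Jinf x u t : K x u t -> inf S <= J x u t.
  by move=> k; apply: ge_inf; [exact: S_inf.2|exists x, u, t].
have adh n : exists p : U * W * R, K p.1.1 p.1.2 p.2 /\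
    J p.1.1 p.1.2 p.2 < inf S + n.+1%:R^-1.
  have n0 : 0 < n.+1%:R^-1 :> R by rewrite invr_gt0.
  have [_ [x [u [t [k ->]]]] lt] := inf_adherent n0 S_inf.
  by exists (x, u, t).
have {adh} [p /all_and2[Kp Jp]] := choice adh.
pose x_ n := (p n).1.1; pose u_ n := (p n).1.2; pose t_ n := (p n).2.
(* At the midpoint [J] is the mean of its end values minus 1/8 of the squared distance, and it is
   still at least [inf S]; hence the constant 8. *)
have cauchy n k : (n <= k)%N ->
    `|x_ n - x_ k| ^+ 2 + `|u_ n - u_ k| ^+ 2 <= 8 / n.+1%:R.
  move=> nk; have h : 0 <= (1 / 2 : R) <= 1 by lra.
  have := Jinf _ _ _ (K_convex h (Kp n) (Kp k)).
  rewrite J_segment -/(x_ n) -/(u_ n) -/(t_ n) -/(x_ k) -/(u_ k) -/(t_ k).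
  have := Jp n; have := Jp k.
  rewrite -/(x_ n) -/(u_ n) -/(t_ n) -/(x_ k) -/(u_ k) -/(t_ k).
  have : J (x_ k) (u_ k) (t_ k) = J (x_ n) (u_ n) (t_ n) +
      (t_ k - t_ n + '<x_ n | x_ k - x_ n> + '<u_ n | u_ k - u_ n>) +
      (`|x_ k - x_ n| ^+ 2 + `|u_ k - u_ n| ^+ 2) / 2.
    have := J_segment 1 (x_ n) (u_ n) (t_ n) (x_ k) (u_ k) (t_ k).
    rewrite !scale1r !mul1r (addrC (x_ n)) (addrC (u_ n)) (addrC (t_ n)) !subrK => ->.
    by rewrite expr1n; lra.
  have : k.+1%:R^-1 <= n.+1%:R^-1 :> R by rewrite lef_pV2 ?posrE// ler_nat.
  rewrite (distrC (x_ n)) (distrC (u_ n)).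
  move: (k.+1%:R^-1) (n.+1%:R^-1) => /= dk dn; lra.
have /cvg_ex[x x_x] : cvg (x_ @ \oo).
  apply: (@cauchy_seq_cvg _ _ _ 8) => n k /cauchy; apply: le_trans.
  by rewrite lerDl sqr_ge0.
have /cvg_ex[u u_u] : cvg (u_ @ \oo).
  apply: (@cauchy_seq_cvg _ _ _ 8) => n k /cauchy; apply: le_trans.
  by rewrite lerDr sqr_ge0.
have cvg_half : (`|x_ n| ^+ 2 + `|u_ n| ^+ 2) / 2 @[n --> \oo] -->
    (`|x| ^+ 2 + `|u| ^+ 2) / 2.
  by apply: cvgMl; apply: cvgD; under eq_fun do rewrite expr2;
    rewrite expr2; apply: cvgM; exact: cvg_norm.
have J_inf : J (x_ n) (u_ n) (t_ n) @[n --> \oo] --> inf S.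
  have h : inf S + n.+1%:R^-1 @[n --> \oo] --> inf S.
    by rewrite -[X in _ --> X]addr0; apply: cvgD; [exact: cvg_cst|exact: cvg_harmonic].
  apply: (squeeze_cvgr _ (cvg_cst (inf S)) h).
  by apply: nearW => n; rewrite (ltW (Jp n)) andbT; exact/Jinf/Kp.
(* The limit of [t_] is forced by the convergence of [J] to its infimum and of the norms. *)
pose t := inf S - (`|x| ^+ 2 + `|u| ^+ 2) / 2.
have t_t : t_ n @[n --> \oo] --> t.
  have -> : t_ = (fun n => J (x_ n) (u_ n) (t_ n) - (`|x_ n| ^+ 2 + `|u_ n| ^+ 2) / 2).
    by apply/funext => n; rewrite /J addrK.
  exact: cvgB.
have Kxut : K x u t by apply: (K_closed Kp x_x u_u t_t).
exists x, u, t; split=> // x' u' t' K'.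
set q := t' - t + '<x | x' - x> + '<u | u' - u>.
have -> : t' + '<x | x' - x> + '<u | u' - u> = t + q by rewrite /q; ring.
rewrite lerDl leNgt; apply/negP => q0.
pose D := `|x' - x| ^+ 2 + `|u' - u| ^+ 2.
have D0 : 0 <= D by rewrite addr_ge0 ?sqr_ge0.
(* If the slope [q] were negative, a step of this length would change [J] by at most
   [s * q / 2 < 0]. The [+ 1] covers the case [D = 0]. *)
pose s := Num.min 1 (- q / (D + 1)).
have s0 : 0 < s by rewrite lt_min ltr01 divr_gt0 ?oppr_gt0// ltr_wpDl.
have s1 : s <= 1 by rewrite ge_min lexx.
have sq : s * (D + 1) <= - q.
  by rewrite -ler_pdivlMr ?ltr_wpDl// ge_min lexx orbT.
have s01 : 0 <= s <= 1 by rewrite ltW.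
have := Jinf _ _ _ (K_convex s01 Kxut K').
rewrite J_segment -/q -/D.
have -> : J x u t = inf S by rewrite /J /t subrK.
nra.
Qed.

End Minimisation.

(* Minimise [|x|^2 / 2 - l x]; the second component of the minimisation lemma is
   idle. *)
Lemma riesz_representation (R : realType) (V : hilbertType R) (l : V -> R) (M : R) :
  (forall a x y, l (a *: x + y) = a * l x + l y) ->
  (forall x, `|l x| <= M * `|x|) ->
  exists y, forall x, l x = '<x | y>.
Proof.
move=> l_lin l_le.
have l0 : l 0 = 0 by apply/eqP; rewrite -normr_le0 (le_trans (l_le 0))// normr0 mulr0.
have lD x y : l (x + y) = l x + l y by rewrite -{1}(scale1r x) l_lin mul1r.
have lZ a x : l (a *: x) = a * l x by rewrite -[a *: x]addr0 l_lin l0 addr0.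
have lN x : l (- x) = - l x by rewrite -scaleN1r lZ mulN1r.
pose K (x u : V) (t : R) := t = - l x.
have [|s x u t x' u' t' _ -> ->|x_ u_ t_ x u t Kn x_x _ t_t||y [u [t [-> hy]]]] :=
  @strongly_convex_minimiser R V V K.
- by exists 0, 0, (- l 0).
- by rewrite /K lD lZ lD lN; ring.
- have lx : - l (x_ n) @[n --> \oo] --> - l x.
    apply: cvgN; apply/subr_cvg0; apply: norm_cvg0.
    have h : M * `|x_ n - x| @[n --> \oo] --> 0.
      rewrite -[X in _ --> X](mulr0 M); apply: cvgMl_tmp.
      by rewrite -(normr0 V); apply: cvg_norm; apply/subr_cvg0.
    apply: (squeeze_cvgr _ (cvg_cst 0) h).
    by apply: nearW => n; rewrite normr_ge0 /= -lN -lD l_le.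
  have tE : t_ = (fun n => - l (x_ n)) by apply/funext => n; exact: Kn.
  by rewrite tE in t_t; exact: (cvg_unique _ t_t lx).
- exists (- M ^+ 2 / 2) => x u t ->.
  have := l_le x; rewrite ler_norml => /andP[_].
  have := sqr_ge0 (`|x| - M); have := sqr_ge0 `|u|; nra.
exists y => x.
(* Optimality is tested at [y + z]; using both [x] and [- x] for [z] then gives equality. *)
have le z : l z <= '<y | z>.
  have := hy (y + z) u _ erefl.
  by rewrite subrr inner0r addr0 (addrC y) addrK lD; lra.
apply/eqP; rewrite eq_le innerC le /=.
by have := le (- x); rewrite lN innerNr lerN2.
Qed.

Section Minty.
Context {R : realType} {V : hilbertType R}.
Implicit Types A : V -> set V.

(** Adjoining [(x, u)] to the graph keeps it [rho]-monotone, so maximality absorbs the pair. This is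
    how maximality is used throughout. *)
Lemma maximally_rho_monotone_mem rho A x u : maximally_rho_monotone rho A ->
  (forall y v, A y v -> rho * `|x - y| ^+ 2 <= '<x - y | u - v>) -> A x u.
Proof.
move=> [monA maxA] rel.
pose A' y := [set v | A y v \/ (y = x /\ v = u)].
suff /maxA h : rho_monotone rho A'.
  have : graph A' (x, u) by right.
  by rewrite h// => p; left.
move=> y v z w; rewrite /graph /= => -[Ayv|[-> ->]] [Azw|[-> ->]].
- exact: monA.
- by rewrite distrC -(opprB x) -(opprB u) innerNl innerNr opprK; apply: rel.
- exact: rel.
- by rewrite !subrr normr0 expr0n mulr0 inner0l.
Qed.

(* Minimise the Fitzpatrick function plus half the squared norm: by the first-order
   condition at a minimiser [(x, u)], the point [(- u, - x)] is monotonically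
   related to the graph of [A], hence lies in it, which forces [u = - x]. *)
Lemma minty0 A : maximally_monotone A -> exists x, A x (- x).
Proof.
move=> Amax.
have [Amon _] := Amax.
have Amon0 x u y v : A x u -> A y v -> 0 <= '<x - y | u - v>.
  by move=> Axu Ayv; have := Amon x u y v Axu Ayv; rewrite mul0r.
have Amem x u : (forall y v, A y v -> 0 <= '<x - y | u - v>) -> A x u.
  by move=> h; apply: (maximally_rho_monotone_mem Amax) => y v /h; rewrite mul0r.
have [a0 [b0 Aab0]] : exists a b, A a b.
  apply: contrapT => A0; apply: (A0); exists 0, 0; apply: Amem => y v Ayv.
  by exfalso; apply: A0; exists y, v.
pose K x u (t : R) := forall a b, A a b -> '<x | b> + '<a | u> - '<a | b> <= t.
(* The Fitzpatrick function dominates the pairing: otherwise [(x, u)] would be monotonically related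
   to [A], hence in its graph, and testing [K] on it gives a contradiction. *)
have K_ge x u t : K x u t -> '<x | u> <= t.
  move=> k; rewrite leNgt; apply/negP => tlt.
  have Axu : A x u.
    apply: Amem => y v Ayv; rewrite !innerE.
    by have := k _ _ Ayv; lra.
  by have := k _ _ Axu; lra.
have [|s x u t x' u' t' s01 k k' a b Aab|x_ u_ t_ x u t Kn x_x u_u t_t a b Aab||x [u [t [k opt]]]] :=
  @strongly_convex_minimiser R V V K.
- exists a0, b0, '<a0 | b0> => a b Aab.
  by have := Amon0 _ _ _ _ Aab0 Aab; rewrite !innerE; lra.
- have := k _ _ Aab; have := k' _ _ Aab; rewrite !innerE; nra.
- apply: (ler_cvg_to (a := \oo) (f := fun n => '<x_ n | b> + '<a | u_ n> - '<a | b>) (g := t_)).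
  + apply: cvgB; last exact: cvg_cst.
    apply: cvgD; first exact: cvg_inner.
    by under eq_fun do rewrite innerC; rewrite innerC; exact: cvg_inner.
  + exact: t_t.
  + by apply: nearW => n; exact: Kn.
- exists 0 => x u t /K_ge k.
  have := sqr_ge0 `|x + u|; rewrite !sqr_normE !innerE (innerC u x); lra.
(* By monotonicity [(a, b)] with height ['<a | b>] lies in [K], so it can be inserted in the
   optimality condition. *)
have rel a b : A a b -> `|x + u| ^+ 2 <= '<- u - a | - x - b>.
  move=> Aab; have Kab : K a b '<a | b>.
    by move=> a' b' Aab'; have := Amon0 _ _ _ _ Aab Aab'; rewrite !innerE; lra.
  have := opt _ _ _ Kab; have := K_ge _ _ _ k.
  rewrite sqr_normE !innerE (innerC u x) (innerC a x); lra.
have Aux : A (- u) (- x).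
  by apply: Amem => y v /rel; apply: le_trans; exact: sqr_ge0.
have := rel _ _ Aux; rewrite subrr inner0l => xu0.
have /eqP : `|x + u| = 0 by apply/eqP; rewrite -(sqrf_eq0 `|x + u|) eq_le xu0 sqr_ge0.
rewrite normr_eq0 addrC addr_eq0 => /eqP uE.
by exists x; rewrite uE opprK in Aux.
Qed.

Lemma minty A rho lambda y : maximally_rho_monotone rho A -> 0 < lambda + rho ->
  exists x, A x (y - lambda *: x).
Proof.
move=> Amax c0; set c := lambda + rho in c0.
have c0' := lt0r_neq0 c0.
(* [A'] is [(A - rho Id - y) / c]. It is maximally monotone, and [A' x (- x)] unfolds to the goal
   because [c = lambda + rho]. *)
pose A' x := [set u | A x (c *: u + rho *: x + y)].
have Amon x u z v : A x u -> A z v -> rho * `|x - z| ^+ 2 <= '<x - z | u - v>.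
  exact: Amax.1.
have Amax' : maximally_monotone A'.
  split=> [x u z v|B Bmon sub].
    rewrite /graph /A' /= => /Amon /[apply]; rewrite sqr_normE !innerE.
    rewrite (innerC z x) mul0r -(pmulr_rge0 _ c0); lra.
  apply/seteqP; split=> // -[x u] Bxu; rewrite /graph /=.
  apply: (maximally_rho_monotone_mem Amax) => z v Azv.
  have A'z : A' z (c^-1 *: (v - rho *: z - y)).
    by rewrite /A' /= scalerA mulfV// scale1r addrAC subrK subrK.
  have := Bmon _ _ _ _ Bxu (sub (z, _) A'z); rewrite mul0r.
  rewrite sqr_normE -(pmulr_rge0 _ c0) -innerZr scalerBr scalerA mulfV// scale1r.
  rewrite !innerE (innerC z x); lra.
have [x /=] := minty0 Amax'; rewrite /A' /= => Ax; exists x.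
rewrite (_ : y - lambda *: x = c *: - x + rho *: x + y)//.
by rewrite /c scalerN scalerDl opprD subrK addrC.
Qed.

End Minty.

(** * Weak limits along ultrafilters *)

Lemma cvg_ultra_real (R : realType) T (F : set_system T) (f : T -> R) (M : R) :
  UltraFilter F -> (forall n, `|f n| <= M) ->
  exists2 l, `|l| <= M & f n @[n --> F] --> l.
Proof.
move=> FU fM; have FP : ProperFilter F by exact: ultra_proper.
have [l [lM l_cluster]] : (`[- M, M]%classic `&` cluster (f @ F)) !=set0.
  apply: segment_compact; apply: nearW => n.
  by rewrite /= in_itv /= -ler_norml.
exists l; first by move: lM; rewrite /= in_itv /= -ler_norml.
move=> B lB; have [//|nB] := in_ultra_setVsetC (f @^-1` B) FU.
by have [r [/= nBr Br]] := l_cluster (~` B) B nB lB.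
Qed.

(** If the preimage of some [B] in [G] were not in [F], the trace of [F] on its complement would
    extend to an ultrafilter finer than [F], which would then contain two disjoint sets. *)
Lemma cvg_of_ultra (S T : Type) (F : set_system S) (f : S -> T) (G : set_system T) :
  Filter F -> (forall U, UltraFilter U -> F `<=` U -> G `<=` f @ U) ->
  G `<=` f @ F.
Proof.
move=> FF cvgU B GB; apply: contrapT => nFB.
pose D := ~` (f @^-1` B).
have wP : ProperFilter (within D F).
  apply: Build_ProperFilter_ex => P FP; apply: contrapT => P0.
  apply: nFB; apply: (@filterS _ F FF _ _ _ FP) => n /= DP.
  by apply: contrapT => nB; apply: P0; exists n; exact: DP.
have [U [UU wU]] := ultraFilterLemma wP.
have UP : ProperFilter U by exact: ultra_proper.
have FU : F `<=` U by move=> P FP; apply: wU; apply: (@filterS _ F FF _ _ _ FP) => n Pn _.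
have UD : U D by apply: wU; apply: (@filterE _ F FF).
have UB : U (f @^-1` B) := cvgU U UU FU B GB.
have [n [/= Dn Bn]] := @filter_ex _ U UP _ (filterI UD UB).
exact: Dn.
Qed.

Definition weakly_cvg_along T (F : set_system T) (R : realType)
    (V : preHilbertType R) (f : T -> V) (x : V) :=
  forall y : V, '<f n | y> @[n --> F] --> '<x | y>.

(* Ultrafilters replace the subsequences of the Banach-Alaoglu theorem. *)
Lemma weakly_cvg_ultra (R : realType) (V : hilbertType R) T (F : set_system T)
    (f : T -> V) (M : R) :
  UltraFilter F -> (forall n, `|f n| <= M) -> exists x, weakly_cvg_along F f x.
Proof.
move=> FU fM; have FP : ProperFilter F by exact: ultra_proper.
have h y : exists l : R, `|l| <= M * `|y| /\ '<f n | y> @[n --> F] --> l.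
  have [|l lM fl] := @cvg_ultra_real R T F (fun n => '<f n | y>) (M * `|y|) FU.
    by move=> n; rewrite (le_trans (normr_inner_le _ _))// ler_wpM2r.
  by exists l.
have [l /all_and2[lM fl]] := choice h.
have [|x lx] := @riesz_representation R V l M _ lM.
  move=> a y z; apply: (cvg_unique _ (fl _)) => //=.
  under eq_fun do rewrite innerDr innerZr.
  by apply: cvgD => //; apply: cvgMl_tmp.
by exists x => y; rewrite (innerC x y) -lx.
Qed.

Lemma cvg_norm_sqr0 T (F : set_system T) (FF : Filter F) (R : realType)
    (V : normedModType R) (f : T -> V) :
  `|f n| ^+ 2 @[n --> F] --> 0 -> `|f n| @[n --> F] --> 0.
Proof.
move=> /cvgrPdist_lt f0; apply/cvgrPdist_lt => e e0.
have := f0 _ (exprn_gt0 2 e0); apply: filterS => n.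
rewrite !sub0r !normrN normr_id ger0_norm ?sqr_ge0//.
by rewrite ltr_pXn2r// ?nnegrE// ltW.
Qed.

(** * Adjoints and resolvents *)

Section BoundedLinearMaps.
Context {R : realType} {V W : hilbertType R} (L : {linear V -> W}).
Hypothesis L_bounded : bounded_fun_norm L.

Lemma norm_le_opnorm x : `|L x| <= opnorm L * `|x|.
Proof.
have [->|x0] := eqVneq x 0; first by rewrite linear0 !normr0 mulr0.
have nx0 : 0 < `|x| by rewrite normr_gt0.
rewrite -ler_pdivrMr//.
have -> : `|L x| / `|x| = `|L (`|x|^-1 *: x)|.
  by rewrite linearZ normrZ normfV normr_id mulrC.
apply: ub_le_sup.
  by have [M hM] := L_bounded 1; exists M => _ [y /= y1 <-]; exact: hM.
exists (`|x|^-1 *: x) => //=.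
by rewrite normrZ normfV normr_id mulVf// normr_eq0.
Qed.

Lemma opnorm_ge0 : 0 <= opnorm L.
Proof.
have [M hM] := L_bounded 1.
apply: (@le_trans _ _ `|L 0|) => //; apply: ub_le_sup.
  by exists M => _ [y /= y1 <-]; exact: hM.
by exists 0 => //=; rewrite normr0.
Qed.

(** Riesz representation shows that the default value of [xget] is not the one returned by
    accident. *)
Lemma adjointP x u : '<L x | u> = '<x | adjoint L u>.
Proof.
have [|y|y hy] := @riesz_representation R V (fun y => '<L y | u>) (opnorm L * `|u|).
- by move=> a y z; rewrite linearP !innerE.
- rewrite (le_trans (normr_inner_le _ _))// mulrAC ler_wpM2r//.
  exact: norm_le_opnorm.
have : exists y, [set y | forall x, '<L x | u> = '<x | y> ] y.
  by exists y => z; rewrite hy innerC.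
by move=> /(xgetPex 0) /=; exact.
Qed.

Lemma cvg_linear0 T (F : set_system T) (FF : Filter F) (f : T -> V) :
  `|f n| @[n --> F] --> 0 -> `|L (f n)| @[n --> F] --> 0.
Proof.
move=> f0; have h : opnorm L * `|f n| @[n --> F] --> 0.
  by rewrite -[X in _ --> X](mulr0 (opnorm L)); apply: cvgMl_tmp.
apply: (squeeze_cvgr _ (cvg_cst 0) h).
by apply: nearW => n; rewrite normr_ge0 norm_le_opnorm.
Qed.

End BoundedLinearMaps.

Section Operators.
Context {R : realType} {V : hilbertType R}.
Implicit Types A : V -> set V.

(** Minty's theorem with [lambda = tau^-1] makes the set behind the resolvent nonempty, so [xget]
    returns a genuine solution; [-1 < tau * rho] is the positivity it requires. *)
Lemma resolvent_scaleP A rho tau y : maximally_rho_monotone rho A ->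
  0 < tau -> -1 < tau * rho ->
  A (resolvent (opscale tau A) y) (tau^-1 *: (y - resolvent (opscale tau A) y)).
Proof.
move=> Amax tau0 taurho.
have tau_n0 := lt0r_neq0 tau0.
set P := opinv (opadd (opfun id) (opscale tau A)) y.
have [|x Ax] := @minty _ _ A rho tau^-1 (tau^-1 *: y) Amax.
  by rewrite -(pmulr_rgt0 _ tau0) mulrDr mulfV//; lra.
have Px : P x.
  exists x => //; exists (tau *: (tau^-1 *: y - tau^-1 *: x)).
    by exists (tau^-1 *: y - tau^-1 *: x).
  by rewrite -scalerBr scalerA mulfV// scale1r addrC subrK.
have : P (resolvent (opscale tau A) y) by apply: (xgetPex 0); exists x.
move=> [_ -> [_ [a Aa <-]]] /= yE; set r := resolvent _ _ in Aa yE *.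
by rewrite -yE addrAC subrr add0r scalerA mulVf// scale1r.
Qed.

Lemma maximally_monotone_opinv A : maximally_monotone A -> maximally_monotone (opinv A).
Proof.
move=> Amax; split=> [u x v y|B Bmon sub].
  rewrite /graph /opinv /= => Axu Ayv; rewrite mul0r innerC.
  by have := Amax.1 x u y v Axu Ayv; rewrite mul0r.
apply/seteqP; split=> // -[u x]; rewrite /graph /opinv /= => Bux.
apply: (maximally_rho_monotone_mem Amax) => y v Ayv; rewrite mul0r innerC.
by have := Bmon u x v y Bux (sub (v, y) Ayv); rewrite mul0r.
Qed.

End Operators.

Lemma kuhn_tuckerP (R : realType) (V W : hilbertType R) (A : V -> set V)
    (C : V -> V) (B : W -> set W) (L : {linear V -> W}) x u :
  kuhn_tucker A C B L x u <->
  opadd A (opfun C) x (- adjoint L u) /\ opinv B u (L x).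
Proof.
split=> [[[a + aE] [b + bE]]|[hA hB]].
  by move/eqP: aE; rewrite addr_eq0 => /eqP <-; move/eqP: bE; rewrite subr_eq0 => /eqP <-.
by split; [exists (- adjoint L u); rewrite ?addNr|exists (L x); rewrite ?subrr].
Qed.

(** * The primal-dual iteration *)

Lemma coercive_quadratic (R : realFieldType) (p q k : R) :
  0 < p -> 0 < q -> k ^+ 2 < p * q ->
  exists2 e, 0 < e & forall a b : R,
    e * (a ^+ 2 + b ^+ 2) <= p * a ^+ 2 + q * b ^+ 2 - 2 * (k * (a * b)).
Proof.
move=> p0 q0 kpq; have pq0 : 0 < p + q by rewrite addr_gt0.
(* Determinant over trace of the symmetric matrix of the form: subtracting [e] times the identity
   leaves the determinant [e ^+ 2]. *)
pose e := (p * q - k ^+ 2) / (p + q).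
have e0 : 0 < e by rewrite divr_gt0 ?subr_gt0.
have eE : e * (p + q) = p * q - k ^+ 2 by rewrite mulfVK ?lt0r_neq0.
have ep : 0 < p - e by rewrite subr_gt0 ltr_pdivrMr//; nra.
exists e => // a b.
rewrite -subr_ge0 -(pmulr_rge0 _ ep).
have -> : (p - e) * (p * a ^+ 2 + q * b ^+ 2 - 2 * (k * (a * b)) -
    e * (a ^+ 2 + b ^+ 2)) =
    ((p - e) * a - k * b) ^+ 2 + (p * q - k ^+ 2 - e * (p + q) + e ^+ 2) * b ^+ 2.
  by ring.
by rewrite -eE subrr add0r addr_ge0 ?sqr_ge0// mulr_ge0// sqr_ge0.
Qed.

Section PrimalDual.
Context {R : realType} {H G : hilbertType R}.
(** The algorithm reduced to its inclusions: [M] stands for [A + C], [N] for the inverse of [B],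
    [theta] for [tau * zeta], and [z_ n] for the iterate z of index n + 1. *)
Variables (L : {linear H -> G}) (M : H -> set H) (N : G -> set G).
Variables (x_ z_ : H^nat) (u_ : G^nat) (tau sigma theta : R).
Hypothesis L_bounded : bounded_fun_norm L.
Hypotheses (M_max : maximally_monotone M) (N_max : maximally_monotone N).
Hypotheses (tau_gt0 : 0 < tau) (sigma_gt0 : 0 < sigma) (theta_ge0 : 0 <= theta).
Hypothesis M_iter : forall n,
  M (z_ n) (tau^-1 *: (x_ n - x_ n.+1) - adjoint L (u_ n)).
Hypothesis N_iter : forall n,
  N (u_ n.+1) (sigma^-1 *: (u_ n - u_ n.+1) + L (z_ n + x_ n.+1 - x_ n)).
Hypothesis x_iter : forall n, `|z_ n - x_ n.+1| <= theta * `|z_ n - x_ n|.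
Hypothesis stepsize : tau * sigma * opnorm L ^+ 2 + theta ^+ 2 < 1.

Let solution a b := M a (- adjoint L b) /\ N b (L a).

Let form (d : H) (f : G) : R :=
  tau^-1 * `|d| ^+ 2 + sigma^-1 * `|f| ^+ 2 - 2 * '<L d | f>.

Let lyapunov a b n := form (x_ n - a) (u_ n - b).

Let M_mono x u y v : M x u -> M y v -> 0 <= '<x - y | u - v>.
Proof. by move=> Mx My; have := M_max.1 x u y v Mx My; rewrite mul0r. Qed.

Let N_mono x u y v : N x u -> N y v -> 0 <= '<x - y | u - v>.
Proof. by move=> Nx Ny; have := N_max.1 x u y v Nx Ny; rewrite mul0r. Qed.

(** Twice the sum of the two monotonicity inequalities, with the scalar products polarised. The term
    in [z_ n - x_ n.+1] is absorbed through [theta], which gives the factor [1 - theta ^+ 2]. *)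
Let lyapunov_step a b n : solution a b ->
  lyapunov a b n.+1 + (tau^-1 * (1 - theta ^+ 2) * `|z_ n - x_ n| ^+ 2 +
    sigma^-1 * `|u_ n.+1 - u_ n| ^+ 2 -
    2 * '<L (z_ n - x_ n) | u_ n.+1 - u_ n>) <= lyapunov a b n.
Proof.
move=> [Ma Nb].
have hM := M_mono (M_iter n) Ma; have hN := N_mono (N_iter n) Nb.
have hx : tau^-1 * `|z_ n - x_ n.+1| ^+ 2 <=
    tau^-1 * (theta ^+ 2 * `|z_ n - x_ n| ^+ 2).
  by rewrite ler_pM2l ?invr_gt0// -exprMn ler_sqr ?nnegrE ?mulr_ge0.
move: hM hN hx; rewrite /lyapunov /form.
move: (x_ n) (x_ n.+1) (z_ n) (u_ n) (u_ n.+1) (tau^-1) (sigma^-1).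
move=> x x' z u u' ti si.
rewrite !sqr_normE !(linearB L) !(linearD L) !innerE -!adjointP//.
rewrite ?(innerC a x) ?(innerC a x') ?(innerC a z) ?(innerC x' x) ?(innerC z x)
  ?(innerC z x') ?(innerC b u) ?(innerC b u') ?(innerC u' u).
rewrite !(innerC _ (L _)); lra.
Qed.

Let inner_linear_ge d f : - 2 * (opnorm L * (`|d| * `|f|)) <= - 2 * '<L d | f>.
Proof.
rewrite ler_nM2l ?oppr_lt0// (le_trans (inner_le_norm _ _))// mulrA.
by rewrite ler_wpM2r// norm_le_opnorm.
Qed.

Let theta_lt1 : theta ^+ 2 < 1.
Proof.
apply: le_lt_trans stepsize; rewrite lerDr.
by rewrite mulr_ge0 ?sqr_ge0// mulr_ge0 ?ltW.
Qed.

Let descent : exists2 e, 0 < e & forall d f, e * (`|d| ^+ 2 + `|f| ^+ 2) <= form d f /\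
  forall a b n, solution a b ->
    lyapunov a b n.+1 + e * (`|z_ n - x_ n| ^+ 2 + `|u_ n.+1 - u_ n| ^+ 2)
    <= lyapunov a b n.
Proof.
have ti0 : 0 < tau^-1 by rewrite invr_gt0.
have si0 : 0 < sigma^-1 by rewrite invr_gt0.
(* The determinant condition is the step size condition divided by [tau * sigma]. The same [e]
   serves for [form], whose first coefficient is at least as large. *)
have [|||e e0 he] := @coercive_quadratic R (tau^-1 * (1 - theta ^+ 2)) sigma^-1 (opnorm L).
- by rewrite mulr_gt0 ?subr_gt0.
- by [].
- rewrite mulrAC -invfM ltr_pdivlMl ?mulr_gt0//.
  by rewrite ltrBrDr.
exists e => // d f; split.
  apply: le_trans (he _ _) _; rewrite /form.
  have := inner_linear_ge d f; have := mulr_ge0 (ltW ti0) (sqr_ge0 theta).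
  move/mulr_ge0/(_ (sqr_ge0 `|d|)); lra.
move=> a b n /(lyapunov_step n); apply: le_trans; rewrite lerD2l.
apply: le_trans (he _ _) _.
have := inner_linear_ge (z_ n - x_ n) (u_ n.+1 - u_ n); lra.
Qed.

Let lyapunov_ge0 a b n : 0 <= lyapunov a b n.
Proof.
have [e e0 /(_ (x_ n - a) (u_ n - b))[h _]] := descent.
by apply: le_trans h; rewrite mulr_ge0 ?addr_ge0 ?sqr_ge0 ?ltW.
Qed.

Let lyapunov_nonincreasing a b : solution a b ->
  {homo lyapunov a b : n m / (n <= m)%N >-> m <= n}.
Proof.
move=> ab; apply/nonincreasing_seqP => n.
have [e e0 /(_ 0 0)[_ /(_ a b n ab)]] := descent; apply: le_trans.
by rewrite lerDl mulr_ge0 ?addr_ge0 ?sqr_ge0 ?ltW.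
Qed.

Let lyapunov_cvg a b : solution a b -> cvg (lyapunov a b @ \oo).
Proof.
move=> ab; apply: nonincreasing_is_cvgn; first exact: lyapunov_nonincreasing.
by exists 0 => _ [n _ <-].
Qed.

Let iterates_bounded a b : solution a b ->
  exists K, forall n, `|x_ n| <= K /\ `|u_ n| <= K.
Proof.
move=> ab; have [e e0 he] := descent.
(* Coercivity bounds the squared distances to [(a, b)]; the bound [s <= 1 + s ^+ 2] avoids a square
   root. *)
exists (`|a| + `|b| + (1 + lyapunov a b 0%N / e)) => n.
have := (he (x_ n - a) (u_ n - b)).1.
move/le_trans/(_ (lyapunov_nonincreasing ab (leq0n n))).
rewrite -/(lyapunov a b 0%N) mulrC -ler_pdivlMr// => h.
have := ler_normD (x_ n - a) a; have := ler_normD (u_ n - b) b; rewrite !subrK.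
have := normr_ge0 a; have := normr_ge0 b.
have := sqr_ge0 (`|x_ n - a| - 1); have := sqr_ge0 (`|u_ n - b| - 1).
have := sqr_ge0 (`|x_ n - a|); have := sqr_ge0 (`|u_ n - b|).
split; nra.
Qed.

Let increments_cvg0 a b : solution a b ->
  `|z_ n - x_ n| @[n --> \oo] --> 0 /\ `|u_ n.+1 - u_ n| @[n --> \oo] --> 0.
Proof.
move=> ab; have [e e0 /(_ 0 0)[_ /(_ a b _ ab) he]] := descent.
have /cvg_ex[l ll] := lyapunov_cvg ab.
have d0 : (lyapunov a b n - lyapunov a b n.+1) / e @[n --> \oo] --> 0.
  rewrite -[X in _ --> X](mul0r e^-1); apply: cvgMl.
  by rewrite -(subrr l); apply: cvgB => //; rewrite cvg_shiftS.
have hd n : `|z_ n - x_ n| ^+ 2 + `|u_ n.+1 - u_ n| ^+ 2 <=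
    (lyapunov a b n - lyapunov a b n.+1) / e.
  by rewrite ler_pdivlMr// mulrC lerBrDl.
split; apply: cvg_norm_sqr0; apply: (squeeze_cvgr _ (cvg_cst 0) d0);
  apply: nearW => n; rewrite sqr_ge0 /= (le_trans _ (hd n))//.
- by rewrite lerDl sqr_ge0.
- by rewrite lerDr sqr_ge0.
Qed.

Let weak_cluster_solution (F : set_system nat) a0 b0 a b :
  ProperFilter F -> \oo `<=` F -> solution a0 b0 ->
  weakly_cvg_along F x_ a -> weakly_cvg_along F u_ b -> solution a b.
Proof.
move=> FF ooF sol xa ub.
have [K /all_and2[xK uK]] := iterates_bounded sol.
have [zx0' uu0'] := increments_cvg0 sol.
have zx0 : `|z_ n - x_ n| @[n --> F] --> 0 by move=> B /zx0' /ooF.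
have uu0 : `|u_ n.+1 - u_ n| @[n --> F] --> 0 by move=> B /uu0' /ooF.
have xx_le n : `|x_ n.+1 - x_ n| <= (1 + theta) * `|z_ n - x_ n|.
  rewrite -(subrKA (z_ n)) (le_trans (ler_normD _ _))// distrC mulrDl mul1r addrC.
  by rewrite lerD2l x_iter.
have xx0 : `|x_ n.+1 - x_ n| @[n --> F] --> 0.
  have h : (1 + theta) * `|z_ n - x_ n| @[n --> F] --> 0.
    by rewrite -[X in _ --> X](mulr0 (1 + theta)); apply: cvgMl_tmp.
  apply: (squeeze_cvgr _ (cvg_cst 0) h).
  by apply: nearW => n; rewrite normr_ge0 xx_le.
have Lxx0 : `|L (x_ n.+1 - x_ n)| @[n --> F] --> 0 by exact: cvg_linear0.
have [K' zK] : exists K', forall n, `|z_ n| <= K'.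
  have [e e0 /(_ 0 0)[_ /(_ a0 b0 _ sol) he]] := descent.
  exists (1 + lyapunov a0 b0 0%N / e + K) => n.
  have := he n; have := lyapunov_nonincreasing sol (leq0n n).
  have := lyapunov_ge0 a0 b0 n.+1.
  move=> l1 l2 l3.
  have : `|z_ n - x_ n| ^+ 2 <= lyapunov a0 b0 0%N / e.
    rewrite ler_pdivlMr// mulrC.
    have := mulr_ge0 (ltW e0) (sqr_ge0 `|u_ n.+1 - u_ n|); lra.
  have := ler_normD (z_ n - x_ n) (x_ n); rewrite subrK.
  have := xK n; have := sqr_ge0 (`|z_ n - x_ n| - 1).
  have := sqr_ge0 (`|z_ n - x_ n|); nra.
(* The two inequalities are added before the limit: each contains a product of two merely weakly
   convergent sequences, and these products cancel in the sum up to a null term. *)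
have limit_mono y v w c : M y v -> N w c ->
    0 <= '<a - y | - adjoint L b - v> + '<b - w | L a - c>.
  move=> My Nw.
  (* [r] collects the terms with a vanishing increment as a factor; [m] is affine in [(x_ n, u_ n)],
     so weak convergence suffices for it. *)
  pose r n := tau^-1 * '<z_ n - y | x_ n - x_ n.+1>
    + sigma^-1 * '<u_ n.+1 - w | u_ n - u_ n.+1>
    + '<u_ n.+1 - w | L (x_ n.+1 - x_ n)>
    + '<L (z_ n) | u_ n.+1 - u_ n>
    - '<v + adjoint L w | z_ n - x_ n> - '<c | u_ n.+1 - u_ n>.
  pose m n := - ('<x_ n | v> - '<y | v>) + '<u_ n | L y> - '<x_ n | adjoint L w>
    - ('<u_ n | c> - '<w | c>).
  have rm n : 0 <= r n + m n.
    have := addr_ge0 (M_mono (M_iter n) My) (N_mono (N_iter n) Nw).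
    rewrite /r /m !(linearB L) !(linearD L) !innerE -!adjointP//.
    rewrite ?(innerC (adjoint L w)) -!adjointP//.
    rewrite (innerC v) (innerC c) (innerC v) (innerC c).
    rewrite !(innerC _ (L _)); lra.
  have zyK n : `|z_ n - y| <= K' + `|y|.
    by rewrite (le_trans (ler_normB _ _))// lerD2r.
  have uwK n : `|u_ n.+1 - w| <= K + `|w|.
    by rewrite (le_trans (ler_normB _ _))// lerD2r.
  have LzK n : `|L (z_ n)| <= opnorm L * K'.
    by rewrite (le_trans (norm_le_opnorm L_bounded _))// ler_wpM2l// opnorm_ge0.
  have xx0' : `|x_ n - x_ n.+1| @[n --> F] --> 0 by under eq_fun do rewrite distrC.
  have uu0'' : `|u_ n - u_ n.+1| @[n --> F] --> 0 by under eq_fun do rewrite distrC.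
  have r0 : r n @[n --> F] --> 0.
    rewrite (_ : 0 = tau^-1 * 0 + sigma^-1 * 0 + 0 + 0 - 0 - 0); last by ring.
    apply: cvgB; last exact: (@cvg_inner0 _ _ _ _ _ (fun=> c) _ `|c|).
    apply: cvgB; last first.
      exact: (@cvg_inner0 _ _ _ _ _ (fun=> v + adjoint L w) _ `|v + adjoint L w|).
    apply: cvgD; last exact: cvg_inner0 LzK uu0.
    apply: cvgD; last exact: cvg_inner0 uwK Lxx0.
    apply: cvgD; apply: cvgMl_tmp; first exact: cvg_inner0 zyK xx0'.
    exact: cvg_inner0 uwK uu0''.
  have mE : m n @[n --> F] --> '<a - y | - adjoint L b - v> + '<b - w | L a - c>.
    rewrite (_ : _ + _ = - ('<a | v> - '<y | v>) + '<b | L y> - '<a | adjoint L w>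
      - ('<b | c> - '<w | c>)); last first.
      by rewrite !innerE -!adjointP// !(innerC _ (L _)); lra.
    apply: cvgB; last by apply: cvgB; [exact: ub|exact: cvg_cst].
    apply: cvgB; last exact: xa.
    apply: cvgD; last exact: ub.
    by apply: cvgN; apply: cvgB; [exact: xa|exact: cvg_cst].
  rewrite -[leRHS]add0r.
  apply: (ler_cvg_to (a := F) (cvg_cst 0) (cvgD r0 mE)).
  exact: nearW.
(* The summed inequality is split by maximality. If [N b (L a)] failed, no [(y, v)] could make the
   first term negative, so [M a (- adjoint L b)] would hold; testing with that pair kills the first
   term and gives [N b (L a)] after all. *)
have Nb : N b (L a).
  apply: contrapT => nN.
  have Ma : M a (- adjoint L b).
    apply: (maximally_rho_monotone_mem M_max) => y v My; rewrite mul0r.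
    rewrite leNgt; apply/negP => lt0; apply: nN.
    apply: (maximally_rho_monotone_mem N_max) => w c Nw; rewrite mul0r.
    by have := limit_mono _ _ _ _ My Nw; lra.
  apply: nN; apply: (maximally_rho_monotone_mem N_max) => w c Nw; rewrite mul0r.
  by have := limit_mono _ _ _ _ Ma Nw; rewrite subrr inner0l add0r.
split=> //; apply: (maximally_rho_monotone_mem M_max) => y v My; rewrite mul0r.
by have := limit_mono _ _ _ _ My Nb; rewrite (subrr b) inner0l addr0.
Qed.

(* Opial's argument: the difference of two Lyapunov functions is affine in the
   iterate, so its limit is attained at both weak limits. *)
Let weak_cluster_unique (F F' : set_system nat) a b a' b' :
  ProperFilter F -> ProperFilter F' -> \oo `<=` F -> \oo `<=` F' ->
  solution a b -> solution a' b' ->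
  weakly_cvg_along F x_ a -> weakly_cvg_along F u_ b ->
  weakly_cvg_along F' x_ a' -> weakly_cvg_along F' u_ b' -> a = a' /\ b = b'.
Proof.
move=> FP FP' ooF ooF' sol sol' xa ub xa' ub'.
pose d := a - a'; pose f := b - b'.
(* The scalar product with [(d, f)] in the metric whose squared norm is [form]. *)
pose l x u := tau^-1 * '<x | d> + sigma^-1 * '<u | f>
  - '<x | adjoint L f> - '<u | L d>.
have l_cvg (E : set_system nat) x u : ProperFilter E ->
    weakly_cvg_along E x_ x -> weakly_cvg_along E u_ u ->
    l (x_ n) (u_ n) @[n --> E] --> l x u.
  move=> EP xx uu; apply: cvgB; last exact: uu.
  apply: cvgB; last exact: xx.
  by apply: cvgD; apply: cvgMl_tmp; [exact: xx|exact: uu].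
have lE n : l (x_ n) (u_ n) =
    (form a b - form a' b' - (lyapunov a b n - lyapunov a' b' n)) / 2.
  rewrite /lyapunov /form /l /d /f; move: (x_ n) (u_ n) => x u.
  rewrite !sqr_normE -!adjointP// !(linearB L) !innerE.
  rewrite ?(innerC a x) ?(innerC a' x) ?(innerC b u) ?(innerC b' u).
  rewrite !(innerC _ (L _)); lra.
have [r lr] : exists r : R, l (x_ n) (u_ n) @[n --> \oo] --> r.
  have /cvg_ex[s hs] := lyapunov_cvg sol; have /cvg_ex[s' hs'] := lyapunov_cvg sol'.
  exists ((form a b - form a' b' - (s - s')) / 2); under eq_fun do rewrite lE.
  by apply: cvgMl; apply: cvgB; [exact: cvg_cst|exact: cvgB].
have lF : l a b = r.
  have lr0 : l (x_ n) (u_ n) @[n --> F] --> r by move=> B /lr /ooF.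
  exact: (cvg_unique _ (l_cvg _ _ _ FP xa ub) lr0).
have lF' : l a' b' = r.
  have lr' : l (x_ n) (u_ n) @[n --> F'] --> r by move=> B /lr /ooF'.
  exact: (cvg_unique _ (l_cvg _ _ _ FP' xa' ub') lr').
have [e e0 /(_ d f)[+ _]] := descent.
(* Both values of [l] equal [r], so [form d f] vanishes and coercivity gives [d = 0] and [f = 0]. *)
have -> : form d f = l a b - l a' b'.
  rewrite /form /l -!adjointP// !sqr_normE {1}/d {1}/f.
  rewrite -/d -/f !(innerC _ f) /d /f !(linearB L) !innerE.
  rewrite ?(innerC a' a) ?(innerC b' b) !(innerC _ (L _)); lra.
rewrite lF lF' subrr pmulr_rle0// => le0.
have := sqr_ge0 `|d|; have := sqr_ge0 `|f| => f0 d0.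
have /eqP : `|d| ^+ 2 = 0 by lra.
have /eqP : `|f| ^+ 2 = 0 by lra.
by rewrite !sqrf_eq0 !normr_eq0 !subr_eq0 => /eqP -> /eqP ->.
Qed.

Theorem primal_dual_weak_cvg :
  (exists a b, M a (- adjoint L b) /\ N b (L a)) ->
  exists a b, [/\ M a (- adjoint L b), N b (L a),
    weakly_cvg x_ a & weakly_cvg u_ b].
Proof.
move=> [a0 [b0 sol]].
have [K /all_and2[xK uK]] := iterates_bounded sol.
have cluster F : UltraFilter F -> \oo `<=` F ->
    exists a b, [/\ solution a b, weakly_cvg_along F x_ a & weakly_cvg_along F u_ b].
  move=> FU ooF; have FP : ProperFilter F by exact: ultra_proper.
  have [a xa] := weakly_cvg_ultra FU xK; have [b ub] := weakly_cvg_ultra FU uK.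
  by exists a, b; split=> //; exact: weak_cluster_solution sol xa ub.
(* One ultrafilter fixes the candidate limit; uniqueness transfers it to every other ultrafilter,
   hence to the whole sequence. *)
have [F [FU ooF]] := ultraFilterLemma (@eventually_filter).
have FP : ProperFilter F by exact: ultra_proper.
have [a [b [ab xa ub]]] := cluster F FU ooF.
have along U : UltraFilter U -> \oo `<=` U ->
    weakly_cvg_along U x_ a /\ weakly_cvg_along U u_ b.
  move=> UU ooU; have UP : ProperFilter U by exact: ultra_proper.
  have [a' [b' [ab' xa' ub']]] := cluster U UU ooU.
  by have [-> ->] := weak_cluster_unique FP UP ooF ooU ab ab' xa ub xa' ub'.
exists a, b; split; [exact: ab.1|exact: ab.2| |] => y; apply: cvg_of_ultra => U UU ooU.
- exact: (along U UU ooU).1.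
- exact: (along U UU ooU).2.
Qed.

End PrimalDual.

(** * The algorithm as an instance of the abstract iteration *)

Theorem corollary4p4 (R : realType) (H G : hilbertType R)
  (A : H -> set H) (rho : R) (hA : maximally_rho_monotone rho A)
  (B : G -> set G) (hB : maximally_monotone B)
  (L : {linear H -> G}) (hL : bounded_fun_norm L)
  (C : H -> H) (zeta : R) (zeta_gt0 : 0 < zeta) (hC : zeta.-lipschitz C)
  (hAC : maximally_monotone (opadd A (opfun C)))
  (hsol : exists (x : H) (u : G), kuhn_tucker A C B L x u)
  (x0 : H) (u0 : G) (sigma tau : R) (sigma_gt0 : 0 < sigma) (tau_gt0 : 0 < tau)
  (htau : -1 < tau * rho)
  (x_ p_ z_ q_ : H^nat) (u_ : G^nat)
  (hx0 : x_ 0%N = x0) (hu0 : u_ 0%N = u0)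
  (hp : forall n, p_ n.+1 = C (x_ n))
  (hz : forall n, z_ n.+1 =
    resolvent (opscale tau A) (x_ n - tau *: (adjoint L (u_ n) + p_ n.+1)))
  (hq : forall n, q_ n.+1 = tau *: (C (z_ n.+1) - p_ n.+1))
  (hu : forall n, u_ n.+1 =
    resolvent (opscale sigma (opinv B))
      (u_ n + sigma *: L (2 *: z_ n.+1 - x_ n - q_ n.+1)))
  (hx : forall n, x_ n.+1 = z_ n.+1 - q_ n.+1)
  (hstep : tau * sigma * opnorm L ^+ 2 + tau ^+ 2 * zeta ^+ 2 < 1) :
  exists (x : H) (u : G),
    weakly_cvg (fun n => (x_ n, u_ n)) (x, u) /\ kuhn_tucker A C B L x u.
Proof.
have x_lip n : `|z_ n.+1 - x_ n.+1| <= tau * zeta * `|z_ n.+1 - x_ n|.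
  rewrite hx opprB addrC subrK hq hp normrZ gtr0_norm// -mulrA ler_pM2l//.
  exact: (hC (z_ n.+1, x_ n) _).
(* The correction [q_] replaces [C (x_ n)] by [C (z_ n.+1)], so both operators are evaluated at the
   same point. *)
have AC_iter n : opadd A (opfun C) (z_ n.+1)
    (tau^-1 *: (x_ n - x_ n.+1) - adjoint L (u_ n)).
  have := resolvent_scaleP (x_ n - tau *: (adjoint L (u_ n) + p_ n.+1))
    hA tau_gt0 htau.
  rewrite -hz => Az.
  exists (tau^-1 *: (x_ n - tau *: (adjoint L (u_ n) + p_ n.+1) - z_ n.+1)) => //.
  exists (C (z_ n.+1)) => //; rewrite hx hq !scalerBr !scalerDr !scalerA mulVf ?lt0r_neq0//.
  rewrite !scale1r opprD !opprB !addrA.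
  by rewrite [LHS](ACl (1*5*3*4*2)).
have B_iter n : opinv B (u_ n.+1)
    (sigma^-1 *: (u_ n - u_ n.+1) + L (z_ n.+1 + x_ n.+1 - x_ n)).
  have := resolvent_scaleP (rho := 0) (u_ n + sigma *: L (2 *: z_ n.+1 - x_ n - q_ n.+1))
    (maximally_monotone_opinv hB) sigma_gt0.
  rewrite mulr0 -hu ltrN10 => /(_ isT).
  rewrite addrAC scalerDr scalerA mulVf ?lt0r_neq0// scale1r hx.
  rewrite (_ : z_ n.+1 + _ - _ = 2 *: z_ n.+1 - x_ n - q_ n.+1)//.
  rewrite scaler_nat mulr2n !addrA.
  by rewrite [LHS]addrAC.
have [x [u sol]] := hsol.
(* The shift is needed because the recurrence does not constrain [z_ 0]. *)
have [|x' [u' [Mx Nu xx uu]]] := primal_dual_weak_cvg (z_ := fun n => z_ n.+1)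
  (theta := tau * zeta) hL hAC (maximally_monotone_opinv hB) tau_gt0 sigma_gt0
  (ltW (mulr_gt0 tau_gt0 zeta_gt0)) AC_iter B_iter x_lip _
  (ex_intro _ x (ex_intro _ u ((kuhn_tuckerP A C B L x u).1 sol))).
  by rewrite exprMn.
exists x', u'; split; last by apply/kuhn_tuckerP.
by move=> y; apply: cvgD; [exact: xx|exact: uu].
Qed.
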